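(* Let $H=(V,E)$ be a finite hypergraph and let $N(H)$ be the number of edge sets $F\subseteq E$ such that $(V,F)$ is a connected hyperforest. Then $$\Bigl|\sum_{\substack{E'\subseteq E,\\ (V,E')\text{ connected}}}(-1)^{|E'|}\Bigr|\le N(H).$$
   Context: A hypergraph $H=(V,E)$ has a finite vertex set $V$ and a set $E$ of nonempty subsets of $V$ (edges). A hypergraph $(V',E')$ is connected if for every partition $V'=V_1\cup V_2$ into two nonempty sets some edge of $E'$ intersects both $V_1$ and $V_2$. For $X\subseteq V'$, $\Gamma(X)$ denotes the set of edges $e\in E'$ with $e\cap X\neq\emptyset$. A hypergraph $(V',E')$ is a hypercircuit if $|V'|=|E'|$ and $|\Gamma(X)|\ge |X|+1$ for every nonempty proper subset $X\subsetneq V'$. A hypergraph is a hyperforest if it contains no sub-hypergraph that is a hypercircuit. $N(H)$ thus counts the connected spanning hyperforests of $H$. *)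

(* Defs.v *)
From mathcomp Require Import all_boot all_order all_algebra.

Set Implicit Arguments.
Unset Strict Implicit.
Unset Printing Implicit Defensive.

Section Hypergraphs.

(* A pair (V, E) carries its own vertex set V inside an ambient finType T, so
   that sub-hypergraphs live on subsets of V without changing type. *)
Variable T : finType.
Implicit Types (V X : {set T}) (E F : {set {set T}}).

Definition is_hypergraph V E : bool :=
  [forall e in E, (e != set0) && (e \subset V)].

(* A hypergraph with at most one vertex, the empty one included, is connected. *)
Definition hconnected V E : bool :=
  [forall V1 : {set T}, forall V2 : {set T},
    [&& V1 :|: V2 == V, [disjoint V1 & V2], V1 != set0 & V2 != set0] ==>
      [exists e in E, (e :&: V1 != set0) && (e :&: V2 != set0)]].

Definition Gamma E X : {set {set T}} := [set e in E | e :&: X != set0].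

(* The clause V != set0 excludes (set0, set0), which satisfies the other two
   clauses vacuously and is contained in every hypergraph. An edge [set v]
   alone on the vertex set [set v] is a hypercircuit (a loop). *)
Definition hypercircuit V E : bool :=
  [&& V != set0, #|V| == #|E| &
    [forall X : {set T},
      (X != set0) && (X \proper V) ==> (#|X| + 1 <= #|Gamma E X|)]].

Definition subhypergraph (V' : {set T}) (E' : {set {set T}}) V E : bool :=
  [&& V' \subset V, E' \subset E & is_hypergraph V' E'].

Definition hyperforest V E : bool :=
  ~~ [exists V' : {set T}, exists E' : {set {set T}},
       subhypergraph V' E' V E && hypercircuit V' E'].

Definition num_connected_hyperforests V E : nat :=
  #|[set F : {set {set T}} |
      [&& F \subset E, hconnected V F & hyperforest V F]]|.

End Hypergraphs.

(* Main.v *)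
Require Import Defs.
From mathcomp Require Import all_boot all_order all_algebra.
From mathcomp Require Import zify.

(** Whitney's broken-circuit argument. Order the edges linearly; a broken
    circuit is a hypercircuit minus its largest edge. By double counting,
    deleting one edge from a hypercircuit leaves it connected, so if F contains
    the broken circuit of C with largest edge e, toggling e in F does not affect
    connectedness. Toggling the smallest such e is a sign-reversing involution
    on the connected edge sets containing a broken circuit, so these cancel. The
    remaining edge sets contain no broken circuit, hence no hypercircuit. *)

Set Implicit Arguments.
Unset Strict Implicit.
Unset Printing Implicit Defensive.

Import Order.TTheory GRing.Theory Num.Theory.

Section SignedSums.

Variable U : finType.
Implicit Types (P : pred {set U}) (F : {set U}) (e f : U).

Definition toggle e F : {set U} := if e \in F then F :\ e else e |: F.

Lemma toggleK e : involutive (toggle e).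
Proof.
move=> F; rewrite /toggle; case: (boolP (e \in F)) => eF.
  by rewrite setD11 setD1K.
by rewrite setU11 setU1K.
Qed.

Lemma sign_toggle e F : ((-1 : int) ^+ #|toggle e F| = - (-1) ^+ #|F|)%R.
Proof.
rewrite /toggle; case: ifPn => eF; last by rewrite cardsU1 eF exprS mulN1r.
by rewrite (cardsD1 e F) eF exprS mulN1r opprK.
Qed.

Lemma sum_sign_toggle_inv P e :
  (forall F, P (toggle e F) = P F) ->
  (\sum_(F | P F) (-1 : int) ^+ #|F| = 0)%R.
Proof.
move=> Pe; set S := (\sum_(F | _) _)%R.
suff: S = (- S)%R by lia.
rewrite {1}/S (reindex_inj (inv_inj (toggleK e))) /S -sumrN.
by apply: eq_big => // F _; rewrite sign_toggle.
Qed.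

(** Bad elements are eliminated one rank at a time. The case [f = e] of the second hypothesis makes
    toggling [e] an involution on the sets where [e] is bad; the cases of smaller rank keep [e] the
    smallest bad element. *)
Lemma sum_sign_cancel P (bad : {set U} -> pred U) :
  (forall F e, bad F e -> P (toggle e F) = P F) ->
  (forall F e f, enum_rank f <= enum_rank e -> bad (toggle e F) f = bad F f) ->
  (\sum_(F | P F) (-1 : int) ^+ #|F| =
   \sum_(F | P F && [forall f, ~~ bad F f]) (-1) ^+ #|F|)%R.
Proof.
move=> Pbad bad_toggle.
pose good k F := [forall f : U, (enum_rank f < k) ==> ~~ bad F f].
suff sum_good k : k <= #|U| ->
    (\sum_(F | P F) (-1 : int) ^+ #|F| =
     \sum_(F | P F && good k F) (-1) ^+ #|F|)%R.
  rewrite (sum_good #|U|) //; apply: eq_bigl => F; congr (_ && _).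
  by apply: eq_forallb => f; rewrite ltn_ord.
elim: k => [_|k IHk ltk].
  by apply: eq_bigl => F; rewrite (_ : good 0 F) ?andbT //; apply/forallP.
rewrite IHk 1?ltnW //; pose e := enum_val (Ordinal ltk).
have rank_e : enum_rank e = k :> nat by rewrite enum_valK.
have goodS F : good k.+1 F = good k F && ~~ bad F e.
  apply/forallP/andP => [gF|[/forallP gF nbad] f].
    split; last by have := gF e; rewrite rank_e ltnSn.
    by apply/forallP => f; apply/implyP => /ltnW ltfk; apply: (implyP (gF f)).
  rewrite ltnS leq_eqVlt; apply/implyP => /orP[/eqP rank_f|]; last exact/implyP.
  by rewrite (_ : f = e) //; apply/enum_rank_inj/val_inj; rewrite /= rank_e.
(* The sets on which [e], of rank [k], is the first bad element sum to zero by toggling [e]; the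
   others are those counted by [good k.+1]. *)
rewrite (bigID (bad^~ e)) /= (@sum_sign_toggle_inv _ e) ?add0r => [|F].
  by apply: eq_bigl => F; rewrite goodS andbA.
rewrite (bad_toggle F e e) //; case: (boolP (bad F e)); rewrite ?andbF // => badF.
rewrite Pbad // !andbT; congr (_ && _); apply: eq_forallb => f.
by case: ltnP => //= ltfk; rewrite bad_toggle // rank_e ltnW.
Qed.

End SignedSums.

Section BrokenCircuits.

Variable T : finType.
Implicit Types (V W X : {set T}) (e f : {set T}) (C E F : {set {set T}}).

Lemma hconnected_sub V E F : E \subset F -> hconnected V E -> hconnected V F.
Proof.
move=> sEF /forallP cE; apply/forallP => V1; apply/forallP => V2.
apply/implyP => V12; have /exists_inP[e eE e12] := implyP (forallP (cE V1) V2) V12.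
by apply/exists_inP; exists e; rewrite ?(subsetP sEF).
Qed.

(** For a bipartition of [W], the two neighbourhoods have total size at least [#|W| + 2 = #|C| + 2],
    while their union has at most [#|C|] edges. So at least two edges cross, and one of them is not
    [e]. *)
Lemma hypercircuitD1_hconnected W C e :
  hypercircuit W C -> hconnected W (C :\ e).
Proof.
case/and3P => _ /eqP cardWC /forallP circ.
apply/forallP => V1; apply/forallP => V2; apply/implyP.
case/and4P => /eqP defW dis12 n1 n2.
have cardW : #|W| = #|V1| + #|V2| by rewrite -defW cardsU disjoint_setI0 ?cards0 ?subn0.
have card1 : 0 < #|V1| by rewrite card_gt0.
have card2 : 0 < #|V2| by rewrite card_gt0.
have G1 : #|V1| + 1 <= #|Gamma C V1|.
  by apply: (implyP (circ V1)); rewrite n1 properEcard -{1}defW subsetUl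
    cardW -addn1 leq_add2l.
have G2 : #|V2| + 1 <= #|Gamma C V2|.
  by apply: (implyP (circ V2)); rewrite n2 properEcard -{1}defW subsetUr
    cardW -add1n leq_add2r.
have GU : #|Gamma C V1 :|: Gamma C V2| <= #|C|.
  by apply/subset_leq_card/subsetP => f; rewrite !inE => /orP[] /andP[].
have cardI : 1 < #|Gamma C V1 :&: Gamma C V2|.
  have := leq_add G1 G2; rewrite -cardsUI addnACA -cardW cardWC.
  by move/leq_trans/(_ (leq_add GU (leqnn _))); rewrite leq_add2l.
have : 0 < #|(Gamma C V1 :&: Gamma C V2) :\ e|.
  by move: cardI; rewrite (cardsD1 e); case: (e \in _) => // /ltnW.
case/card_gt0P => f; rewrite !inE => /and3P[nfe /andP[fC f1] /andP[_ f2]].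
by apply/exists_inP; exists f; rewrite ?inE ?nfe ?f1.
Qed.

(** If [e] crosses a bipartition of [V], then so does [W], which contains [e]. The bipartition thus
    restricts to a proper one of [W], and an edge of [F] crossing the latter can replace [e]. *)
Lemma hconnectedU1 V W F e :
  W \subset V -> e \subset W -> hconnected W F ->
  hconnected V (e |: F) = hconnected V F.
Proof.
move=> sWV seW /forallP cW; apply/idP/idP; last exact/hconnected_sub/subsetUr.
move=> /forallP cV; apply/forallP => V1; apply/forallP => V2; apply/implyP => V12.
have /exists_inP[f] := implyP (forallP (cV V1) V2) V12.
rewrite in_setU1 => /predU1P[-> /andP[e1 e2]|fF f12]; last first.
  by apply/exists_inP; exists f.
have [/eqP defV dis12 _ _] := and4P V12.
have meetW X : e :&: X != set0 -> W :&: X != set0.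
  by apply: contraNneq => WX0; rewrite -subset0 -WX0 setSI.
have /exists_inP[g gF /andP[g1 g2]] : [exists g in F,
    (g :&: (W :&: V1) != set0) && (g :&: (W :&: V2) != set0)].
  apply: (implyP (forallP (cW (W :&: V1)) (W :&: V2))).
  rewrite -setIUr defV (setIidPl sWV) eqxx (meetW _ e1) (meetW _ e2) !andbT /=.
  by apply: disjointWl (subsetIr _ _) _; apply: disjointWr (subsetIr _ _) dis12.
have subI X : g :&: (W :&: X) != set0 -> g :&: X != set0.
  by apply: contraNneq => gX0; rewrite -subset0 -gX0 setIS // subsetIr.
by apply/exists_inP; exists g => //; rewrite (subI _ g1) (subI _ g2).
Qed.

(** The circuit is taken in [E] and [F] only has to contain it up to [e], so that membership of [e]
    in [F] is left free for toggling. *)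
Definition has_broken_circuit V E F e : bool :=
  [exists W : {set T}, exists C : {set {set T}},
    [&& subhypergraph W C V E, hypercircuit W C, e \in C, C :\ e \subset F &
      [forall f in C, enum_rank f <= enum_rank e]]].

Lemma sub_toggle E F e : e \in E -> (toggle e F \subset E) = (F \subset E).
Proof.
move=> eE; rewrite /toggle; case: ifPn => eF; last by rewrite subUset sub1set eE.
by rewrite -{2}(setD1K eF) subUset sub1set eE.
Qed.

Lemma hconnected_toggle V E F e :
  has_broken_circuit V E F e -> hconnected V (toggle e F) = hconnected V F.
Proof.
case/existsP => W /existsP[C /and5P[/and3P[sWV _ /forall_inP hC] circ eC sCF _]].
have /andP[_ seW] := hC e eC.
have cWF F' : C :\ e \subset F' -> hconnected W F'.
  by move/hconnected_sub; apply; apply: hypercircuitD1_hconnected.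
rewrite /toggle; case: ifPn => eF; last exact: hconnectedU1 seW (cWF _ sCF).
(* When [e] is in [F], the base set is [F :\ e], which still contains [C :\ e]. *)
rewrite -{2}(setD1K eF) (hconnectedU1 sWV seW) // cWF //.
by apply/subsetP => f fC; rewrite in_setD1 (subsetP sCF) // andbT; case/setD1P: fC.
Qed.

(** Since [f] is the largest edge of [C], all edges of [C :\ f] rank strictly below [f], hence below
    [e]; toggling [e] cannot touch them. *)
Lemma has_broken_circuit_toggle V E F e f :
  enum_rank f <= enum_rank e ->
  has_broken_circuit V E (toggle e F) f = has_broken_circuit V E F f.
Proof.
move=> le_fe; apply: eq_existsb => W; apply: eq_existsb => C.
case: (_ C V E) => //=; case: (hypercircuit W C) => //=; case: (f \in C) => //=.
rewrite andbC [RHS]andbC; case: forall_inP => //= maxf.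
have neC : e \notin C :\ f.
  rewrite in_setD1; apply/andP => -[nef /maxf le_ef]; case/eqP: nef.
  by apply/enum_rank_inj/val_inj/anti_leq; rewrite le_ef.
have toggle_neq g : g \in C :\ f -> (g \in toggle e F) = (g \in F).
  move=> gC; have /negPf nge : g != e by apply: contraNneq neC => <-.
  by rewrite /toggle; case: ifP; rewrite !inE nge.
by apply/subsetP/subsetP => sC g gC; have := sC g gC; rewrite toggle_neq.
Qed.

Lemma no_broken_circuit_hyperforest V E F :
  F \subset E -> [forall e, ~~ has_broken_circuit V E F e] -> hyperforest V F.
Proof.
move=> sFE /forallP nbc.
apply/existsP => -[W /existsP[C /andP[/and3P[sWV sCF hC] circ]]].
(* A largest edge exists because [#|C| = #|W|] is positive. *)
have [e0 e0C] : exists e, e \in C.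
  by have /and3P[] := circ; rewrite -card_gt0 => + /eqP cWC _; rewrite cWC => /card_gt0P.
case: (arg_maxnP (fun e => enum_rank e : nat) e0C) => e eC maxe.
case/negP: (nbc e); apply/existsP; exists W; apply/existsP; exists C.
apply/and5P; split => //; last exact/forall_inP.
  by rewrite /subhypergraph sWV hC (subset_trans sCF).
exact: subset_trans (subD1set _ _) sCF.
Qed.

End BrokenCircuits.

Theorem theorem2 (T : finType) (V : {set T}) (E : {set {set T}})
    (hE : is_hypergraph V E) :
  (`| \sum_(E' : {set {set T}} | (E' \subset E) && hconnected V E')
        (-1 : int) ^+ #|E'| | <= (num_connected_hyperforests V E)%:Z)%R.
Proof.
rewrite (@sum_sign_cancel _ _ (has_broken_circuit V E)); last first.
- by move=> F e f; apply: has_broken_circuit_toggle.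
- move=> F e bF; rewrite (hconnected_toggle bF) sub_toggle //.
  by case/existsP: bF => W /existsP[C /and5P[/and3P[_ /subsetP sCE _] _ /sCE]].
(* Each surviving term has absolute value 1, so the triangle inequality leaves a count of edge
   sets. *)
apply: le_trans (ler_norm_sum _ _ _) _.
under eq_bigr do rewrite normrX normrN1 expr1n.
rewrite sumr_const pmulrn intz lez_nat.
apply/subset_leq_card/subsetP => F; rewrite !inE => /andP[/andP[sFE cF] nbc].
by rewrite sFE cF (no_broken_circuit_hyperforest sFE nbc).
Qed.
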